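(* For every real $\varepsilon$ with $0<\varepsilon\leq 1$ and every positive integer $r$, there exist $\Delta_0$ and a constant $C_2\leq \varepsilon^{-2}(7r+170)+r+5$ such that $$\chi''_{a,r}(G)\leq\Delta(G)+C_1+C_2$$ for every graph $G$ with $\delta(G)\geq \varepsilon\Delta(G)$ and $\Delta(G)\geq \Delta_0$, where $C_1$ is the Molloy–Reed constant, i.e. a constant such that for some $D_0$ every graph $H$ with $\Delta(H)\geq D_0$ satisfies $\chi''(H)\leq\Delta(H)+C_1$.
   Context: Graphs are finite and simple. For a graph $G=(V,E)$, $\Delta(G)$ and $\delta(G)$ denote its maximum and minimum degrees, $E(v)$ is the set of edges incident with a vertex $v$, and $d(u,v)$ is the distance between $u$ and $v$ in $G$. A proper total colouring of $G$ with $k$ colours is a map $c:E\cup V\to\{1,2,\ldots,k\}$ such that no two adjacent vertices get the same colour, no two edges sharing an endpoint get the same colour, and no edge gets the same colour as one of its endpoints. The total chromatic number $\chi''(G)$ is the least $k$ for which $G$ has a proper total colouring with $k$ colours. The pallet of a vertex $v$ under $c$ is $S_c(v):=\{c(e):e\in E(v)\}\cup\{c(v)\}$. For a positive integer $r$, vertices $u,v$ are $r$-neighbours if $1\leq d(u,v)\leq r$. The $r$-distant set distinguishing total number $\chi''_{a,r}(G)$ is the least $k$ for which there is a proper total colouring $c$ of $G$ with $k$ colours such that $S_c(u)\neq S_c(v)$ for every pair of $r$-neighbours $u,v\in V$. Known theorem (Molloy and Reed, 1998), which defines $C_1$: there exist constants $D_0$ and $C_1$ such that for every graph $H$ with $\Delta(H)\geq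 D_0$, $\chi''(H)\leq\Delta(H)+C_1$; in particular one can take $C_1\leq 10^{26}$. The constant $C_1$ is fixed once and for all and does not depend on $\varepsilon$ or $r$. *)

(* Defs.v *)
From mathcomp Require Import all_boot all_order all_algebra reals.

Set Implicit Arguments.
Unset Strict Implicit.
Unset Printing Implicit Defensive.

Import Order.TTheory GRing.Theory Num.Theory.

Record sgraph := SGraph {
  vertex :> finType;
  adj : rel vertex;
  adj_sym : symmetric adj;
  adj_irrefl : irreflexive adj }.

Definition deg (G : sgraph) (v : G) : nat := #|[set w | adj v w]|.

Definition max_deg (G : sgraph) : nat := \max_(v : G) deg v.

(* Every degree is smaller than #|G|, so the default value #|G| is only
   reached by the graph without vertices, where it is 0. *)
Definition min_deg (G : sgraph) : nat := \big[minn/#|G|]_(v : G) deg v.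

Definition is_edge (G : sgraph) (A : {set G}) : bool :=
  [exists u : G, exists v : G, adj u v && (A == [set u; v])].

Notation edge G := {A : {set vertex G} | is_edge A}.

Definition walk (G : sgraph) (n : nat) (u v : G) : bool :=
  [exists p : n.-tuple G, path (@adj G) u p && (last u p == v)].

Lemma connect_walk (G : sgraph) (u v : G) :
  connect (@adj G) u v -> exists n, walk n u v.
Proof.
case/connectP=> p up ->; exists (size p).
by apply/existsP; exists (in_tuple p); rewrite up eqxx.
Qed.

(* None is the infinite distance between distinct components. *)
Definition dist (G : sgraph) (u v : G) : option nat :=
  if @idP (connect (@adj G) u v) is ReflectT uv
  then Some (ex_minn (connect_walk uv)) else None.

Definition r_neighbours (G : sgraph) (r : nat) (u v : G) : bool :=
  if dist u v is Some d then 1 <= d <= r else false.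

(* A total colouring is a function on the disjoint union of V and E; the k
   colours are 0, ..., k - 1. *)
Notation colouring G k := {ffun (vertex G + edge G)%type -> 'I_k}.

Definition proper_total (G : sgraph) (k : nat) (c : colouring G k) : bool :=
  [&& [forall u : G, forall v : G, adj u v ==> (c (inl u) != c (inl v))],
      [forall e : edge G, forall f : edge G,
         (e != f) && (val e :&: val f != set0) ==> (c (inr e) != c (inr f))]
    & [forall e : edge G, forall v : G,
         (v \in val e) ==> (c (inr e) != c (inl v))]].

Definition pallet (G : sgraph) (k : nat) (c : colouring G k) (v : G) :
    {set 'I_k} :=
  c (inl v) |: [set c (inr e) | e : edge G & v \in val e].

Definition r_distinguishing (G : sgraph) (r k : nat) (c : colouring G k) :
    bool :=
  [forall u : G, forall v : G,
     r_neighbours r u v ==> (pallet c u != pallet c v)].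

Definition total_colourable (G : sgraph) (k : nat) : bool :=
  [exists c : colouring G k, proper_total c].

Definition distinguishing_total_colourable (G : sgraph) (r k : nat) : bool :=
  [exists c : colouring G k, proper_total c && r_distinguishing r c].

Lemma walk0 (G : sgraph) (u : G) : walk 0 u u.
Proof. by apply/existsP; exists [tuple]; rewrite /= eqxx. Qed.

Lemma r_neighbours_neq (G : sgraph) (r : nat) (u v : G) :
  r_neighbours r u v -> u != v.
Proof.
rewrite /r_neighbours /dist; case: {-}_ / idP => // uv.
case: ex_minnP => d _ min_d /andP[d_gt0 _]; apply/eqP => eq_uv.
by have := min_d 0; rewrite eq_uv walk0 leqNgt d_gt0 => /(_ isT).
Qed.

Lemma distinguishing_total_colourable_ex (G : sgraph) (r : nat) :
  exists k, distinguishing_total_colourable G r k.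
Proof.
exists #|{: vertex G + edge G}|; apply/existsP.
pose c : colouring G #|{: vertex G + edge G}| := [ffun x => enum_rank x].
have cE x y : (c x == c y) = (x == y).
  by rewrite !ffunE (inj_eq enum_rank_inj).
exists c; apply/andP; split.
  apply/and3P; split; apply/forallP => x; apply/forallP => y; apply/implyP.
  - by rewrite cE; apply: contraL => /eqP[->]; rewrite adj_irrefl.
  - by rewrite cE; case/andP=> + _; apply: contra => /eqP[->].
  - by rewrite cE.
apply/forallP => u; apply/forallP => v; apply/implyP => /r_neighbours_neq uv.
apply/eqP => /setP/(_ (c (inl u))); rewrite setU11 => /esym.
case/setU1P => [/eqP|/imsetP[e _ /eqP]]; rewrite cE //.
by case/eqP => eq_uv; rewrite eq_uv eqxx in uv.
Qed.

Lemma total_colourable_ex (G : sgraph) : exists k, total_colourable G k.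
Proof.
have [k /existsP[c /andP[c_proper _]]] := distinguishing_total_colourable_ex G 0.
by exists k; apply/existsP; exists c.
Qed.

Definition total_chromatic_number (G : sgraph) : nat :=
  ex_minn (total_colourable_ex G).

Definition distinguishing_total_number (G : sgraph) (r : nat) : nat :=
  ex_minn (distinguishing_total_colourable_ex G r).

Local Open Scope ring_scope.

Definition molloy_reed_constant (R : realType) (C1 : R) : Prop :=
  exists D0 : nat, forall H : sgraph, (D0 <= max_deg H)%N ->
    (total_chromatic_number H)%:R <= (max_deg H)%:R + C1.

(* Main.v *)
Require Import Defs.
From mathcomp Require Import all_boot all_order all_algebra reals.
From mathcomp Require Import zify ring lra.

(* Start from a total colouring with Delta + C1 colours and recolour with new
   colours the edges of a subgraph F' of bounded degree, in which every degree
   is at least k = r + 5.  If u and v then had the same pallet, then every old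
   colour lost by u would either be one of the boundedly many colours in the old
   pallet of u but not in that of v, or be lost by v too.  It remains to choose
   F' such that, for r-neighbours u and v, fewer than k - 1 = r + 4 edges of F'
   at u (other than uv) have such a colour.

   For this every vertex draws k * M of its edges at random, M of order
   log Delta, as k groups of M.  A fixed pair (u, v) violates the requirement
   for the drawn edges with probability at most
   Delta ^ -(r + 4) up to logarithmic factors, and a vertex receives more than
   D * M draws with probability at most 2 ^ -M, so the local lemma applies, the
   dependency degree being O(Delta ^ (r + 2)).  The requirement passes to
   subsets, and Hall's theorem with capacities selects one edge from every
   group so that each vertex receives at most D = O(k / eps) of them.  F' thus
   has degrees between k and k + D, and 2 * (k + D) - 1 new colours suffice
   greedily. *)

Set Implicit Arguments.
Unset Strict Implicit.
Unset Printing Implicit Defensive.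

(** * The local lemma on a finite product space *)

Lemma leq_card_bigcup (I T : finType) (P : pred I) (F : I -> {set T}) :
  #|\bigcup_(i | P i) F i| <= \sum_(i | P i) #|F i|.
Proof.
elim/big_rec2: _ => [|i n U _ le_nU]; first by rewrite cards0.
by rewrite (leq_trans (leq_card_setU _ _)) // leq_add2l.
Qed.

Section LocalLemma.

Variables (I A : finType).
Implicit Types (w : {ffun I -> A}) (P Q : pred {ffun I -> A}).

Definition depends_on (V : {set I}) P :=
  forall w w', {in V, w =1 w'} -> P w = P w'.

Definition splice (V : {set I}) w w' : {ffun I -> A} :=
  [ffun i => if i \in V then w i else w' i].

(* Exchanging two outcomes on V is an involution of the squared space which
   maps P x Q onto (P /\ Q) x Omega. *)
Lemma independence (V : {set I}) P Q :
  depends_on V P -> depends_on (~: V) Q ->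
  #|[set w | P w && Q w]| * #|{: {ffun I -> A}}| =
  #|[set w | P w]| * #|[set w | Q w]|.
Proof.
move=> dP dQ; rewrite -[#|{: _}|]cardsT -!cardsX.
pose f (p : {ffun I -> A} * {ffun I -> A}) :=
  (splice V p.1 p.2, splice V p.2 p.1).
have fK : involutive f.
  by case=> w w'; rewrite /f /=; congr (_, _); apply/ffunP => i; rewrite !ffunE;
    case: (i \in V).
rewrite -(card_imset _ (inv_inj fK)); apply: eq_card => p.
rewrite -[p]fK (mem_imset _ _ (inv_inj fK)); case: (f p) => w w'; rewrite /f.
rewrite !inE /= andbT; congr andb; first by apply: dP => i Vi; rewrite ffunE Vi.
by apply: dQ => i; rewrite ffunE inE => /negbTE->.
Qed.

Variables (J : finType) (bad : J -> pred {ffun I -> A}) (V : J -> {set I}).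
Variable d : nat.
Hypothesis d_gt0 : 0 < d.
Hypothesis dep : forall j, depends_on (V j) (bad j).
Hypothesis deg_dep : forall j, #|[set i | ~~ [disjoint V i & V j]]| <= d.
Hypothesis rare :
  forall j, #|[set w | bad j w]| * (4 * d) <= #|{: {ffun I -> A}}|.
Hypothesis inhabited : 0 < #|{: {ffun I -> A}}|.

Let good (S : {set J}) w := [forall j in S, ~~ bad j w].

Let good_dep (S : {set J}) j :
  {in S, forall i, [disjoint V i & V j]} -> depends_on (~: V j) (good S).
Proof.
move=> disj w w' eq_ww'; apply: eq_forallb_in => i Si.
congr (~~ _); apply: dep => x Vx; apply: eq_ww'; rewrite inE.
by apply: contraL (disj i Si) => Vjx; apply/pred0Pn; exists x; rewrite /= Vx.
Qed.

Let goodU1 (S : {set J}) j : #|[set w | good (j |: S) w]| +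
  #|[set w | bad j w && good S w]| = #|[set w | good S w]|.
Proof.
rewrite -cardsUI [X in _ + #|pred_of_set X|](_ : _ = set0).
  rewrite cards0 addn0; apply: eq_card => w; rewrite !inE.
  apply/orP/idP => [[/forallP gS|/andP[]//]|gS].
    by apply/forallP => i; apply/implyP => Si; apply: (implyP (gS i)); rewrite inE Si orbT.
  case bj: (bad j w); [by right|left].
  apply/forallP => i; apply/implyP; case/setU1P => [->|Si]; first by rewrite bj.
  by apply: (implyP (forallP gS i)).
apply/setP => w; rewrite !inE; apply/negP => /andP[/forallP/(_ j)].
by rewrite !inE eqxx /= => /negbTE->.
Qed.

Let goodU (S T : {set J}) : #|[set w | good S w]| <=
  #|[set w | good (T :|: S) w]| + \sum_(j in T) #|[set w | bad j w && good S w]|.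
Proof.
apply: (@leq_trans #|[set w | good (T :|: S) w]
    :|: \bigcup_(j in T) [set w | bad j w && good S w]|); last first.
  by rewrite (leq_trans (leq_card_setU _ _)) // leq_add2l leq_card_bigcup.
apply/subset_leq_card/subsetP => w; rewrite !inE => gS.
case: (boolP [exists j in T, bad j w]) => [/exists_inP[j Tj bj]|nb].
  by apply/orP; right; apply/bigcupP; exists j => //; rewrite inE bj.
apply/orP; left; apply/forall_inP => j; case/setUP => [Tj|].
  by apply: contra nb => bj; apply/exists_inP; exists j.
exact: (forall_inP gS).
Qed.

(* The conditional probability of [bad j] given [good S] is at most
   [(2 * d)^-1]. *)
Let conditionally_rare (S : {set J}) j :
  #|[set w | bad j w && good S w]| * (2 * d) <= #|[set w | good S w]|.
Proof.
have [n] := ubnP #|S|; elim: n => // n IHn in S j *; rewrite ltnS => leSn.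
(* [S1] collects the events that share coordinates with [j], [S2] those that do not. Passing from
   [S] to [S2] costs at most a factor 2, which the constant 4 in [rare] pays for. *)
pose S1 := [set i in S | ~~ [disjoint V i & V j]].
pose S2 := [set i in S | [disjoint V i & V j]].
have S12 : S1 :|: S2 = S.
  by apply/setP => i; rewrite !inE -andb_orr orNb andbT.
have sub_good w : good S w -> good S2 w.
  move=> /forall_inP gS; apply/forall_inP => i.
  by rewrite inE => /andP[/gS].
have le1 : #|[set w | bad j w && good S w]| * (4 * d) <=
    #|[set w | good S2 w]|.
  apply: (@leq_trans (#|[set w | bad j w && good S2 w]| * (4 * d))).
    rewrite leq_mul2r subset_leq_card ?orbT //; apply/subsetP => w.
    by rewrite !inE => /andP[-> /sub_good].
  rewrite -(leq_pmul2r inhabited) mulnAC (@independence (V j)) //.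
    by rewrite mulnAC [leqRHS]mulnC leq_mul2r rare orbT.
  by apply: good_dep => i; rewrite inE => /andP[].
have le2 : #|[set w | good S2 w]| <= 2 * #|[set w | good S w]|.
  have [S1_0|/set0Pn[i S1i]] := eqVneq S1 set0.
    by rewrite -[in leqRHS]S12 S1_0 set0U leq_pmull.
  have ltS2 : #|S2| < n.
    apply: leq_trans leSn; apply/proper_card/properP; split.
      by apply/subsetP => x; rewrite inE => /andP[].
    by move: S1i; rewrite inE => /andP[Si ndi]; exists i; rewrite // inE negb_and ndi orbT.
  have := goodU S2 S1; rewrite S12 => leU.
  (* By induction each event of [S1] has conditional probability at most [1 / (2 * d)] given
     [good S2]. There are at most [d] of them, so at least half of the outcomes survive. *)
  have : (\sum_(j in S1) #|[set w | bad j w && good S2 w]|) * (2 * d) <=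
      d * #|[set w | good S2 w]|.
    rewrite big_distrl /=.
    apply: (@leq_trans (\sum_(j in S1) #|[set w | good S2 w]|)).
      by apply: leq_sum => x _; apply: IHn.
    rewrite sum_nat_const leq_mul2r; apply/orP; right.
    apply: leq_trans (deg_dep j); apply/subset_leq_card/subsetP => x.
    by rewrite !inE => /andP[].
  by nia.
by nia.
Qed.

(** When the events are added one at a time, each keeps at least a proportion [1 - 1 / (2 * d)] of
    the good outcomes, so some always remain. *)
Lemma local_lemma : exists w, forall j, ~~ bad j w.
Proof.
suff: 0 < #|[set w | good setT w]|.
  by case/card_gt0P => w; rewrite inE => /forall_inP g; exists w => j; apply: g.
suff main n (S : {set J}) : #|S| = n -> 0 < #|[set w | good S w]|.
  exact: main erefl.
elim: n S => [|n IHn] S cS.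
  move/cards0_eq: cS => ->; apply: leq_trans inhabited _; rewrite -cardsT.
  apply/subset_leq_card/subsetP => w _; rewrite inE.
  by apply/forall_inP => j; rewrite inE.
have /card_gt0P[j Sj] : 0 < #|S| by rewrite cS.
have := IHn (S :\ j); rewrite (cardsD1 j) Sj add1n in cS.
case: cS => -> /(_ erefl) g_gt0.
have := goodU1 (S :\ j) j; rewrite setD1K // => eqg.
have := conditionally_rare (S :\ j) j; nia.
Qed.

End LocalLemma.

(** * Selection, colouring and counting on finite types *)

(* A family that is minimal for the hypothesis consists of singletons: if
   removing y1 from N x0 violates it at S1 and removing y2 violates it at S2,
   submodularity gives a contradiction at S1 :|: S2 and S1 :&: S2 minus x0. *)
Lemma hall_capacity (X Y : finType) (D : nat) (N : X -> {set Y}) :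
  (forall S : {set X}, #|S| <= D * #|\bigcup_(x in S) N x|) ->
  exists h : X -> Y,
    (forall x, h x \in N x) /\ (forall y, #|[set x | h x == y]| <= D).
Proof.
have [n] := ubnP (\sum_x #|N x|); elim: n N => // n IHn N; rewrite ltnS => leNn hallN.
have [/existsP[x0 /card_gt1P[y1 [y2 [Ny1 Ny2 neq12]]]]|] :=
    boolP [exists x, 1 < #|N x|]; last first.
  rewrite negb_exists => /forallP card_le1.
  have card1 x : exists y, N x == [set y].
    have := hallN [set x]; rewrite cards1 big_set1 => gt0.
    have := card_le1 x; rewrite -leqNgt => le1.
    have /cards1P[y ->] : #|N x| == 1.
      by rewrite eqn_leq le1; case: #|_| gt0; rewrite ?muln0.
    by exists y.
  pose h x := xchoose (card1 x); have Nh x : N x = [set h x].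
    exact/eqP/(xchooseP (card1 x)).
  exists h; split=> [x|y]; first by rewrite Nh set11.
  rewrite (leq_trans (hallN _)) // -[leqRHS]muln1 leq_mul2l -(cards1 y).
  apply/orP; right; apply/subset_leq_card/bigcupsP => x.
  by rewrite inE Nh => /eqP->.
pose del y x := if x == x0 then N x0 :\ y else N x.
have del_sub y x : del y x \subset N x.
  by rewrite /del; case: eqP => [->|_]; rewrite // subD1set.
have step y : y \in N x0 ->
    (forall S : {set X}, #|S| <= D * #|\bigcup_(x in S) del y x|) ->
    exists h : X -> Y,
    (forall x, h x \in N x) /\ (forall y, #|[set x | h x == y]| <= D).
  move=> Ny /IHn[|h [hN hD]].
    apply: leq_trans leNn; rewrite (bigD1 x0) //= [ltnRHS](bigD1 x0) //=.
    rewrite -addSn leq_add //; first by rewrite /del eqxx [ltnRHS](cardsD1 y) Ny.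
    by apply: leq_sum => x _; apply/subset_leq_card/del_sub.
  by exists h; split=> // x; apply: (subsetP (del_sub y x)).
have [/forallP|] := boolP [forall S : {set X}, #|S| <= D * #|\bigcup_(x in S) del y1 x|].
  exact: step.
rewrite negb_forall => /existsP[S1]; rewrite -ltnNge => bad1.
have [/forallP|] := boolP [forall S : {set X}, #|S| <= D * #|\bigcup_(x in S) del y2 x|].
  exact: step.
rewrite negb_forall => /existsP[S2]; rewrite -ltnNge => bad2.
(* The deletion does not affect a set without [x0], so every violating set contains [x0]. *)
have inS y (S : {set X}) : D * #|\bigcup_(x in S) del y x| < #|S| -> x0 \in S.
  apply: contraTT => nS; rewrite -leqNgt (leq_trans (hallN S)) // leq_mul2l.
  apply/orP; right; apply/subset_leq_card/bigcupsP => x Sx.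
  apply: (bigcup_max x) => //; rewrite /del.
  by case: eqP nS => // <-; rewrite Sx.
have S1x := inS _ _ bad1; have S2x := inS _ _ bad2.
set U1 := (X in _ * #|pred_of_set X| < _) in bad1.
set U2 := (X in _ * #|pred_of_set X| < _) in bad2.
(* Since [y1 != y2], every element of [N x0] survives one of the two deletions. *)
have leU : #|S1 :|: S2| <= D * #|U1 :|: U2|.
  rewrite (leq_trans (hallN _)) // leq_mul2l; apply/orP; right.
  apply/subset_leq_card/bigcupsP => x Sx; apply/subsetP => y Ny; rewrite inE.
  have [eqx|neqx] := eqVneq x x0; last first.
    by apply/orP; case/setUP: Sx => Sx; [left|right]; apply/bigcupP;
      exists x => //; rewrite /del (negPf neqx).
  have [eqy|neqy] := eqVneq y y1; apply/orP; [right|left]; apply/bigcupP; exists x0 => //;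
    rewrite /del eqxx !inE -eqx Ny andbT //.
  by rewrite eqy.
have leI : #|(S1 :&: S2) :\ x0| <= D * #|U1 :&: U2|.
  rewrite (leq_trans (hallN _)) // leq_mul2l; apply/orP; right.
  apply/subset_leq_card/bigcupsP => x; rewrite !inE => /and3P[neqx Sx1 Sx2].
  by rewrite subsetI; apply/andP; split; apply: (bigcup_max x) => //;
    rewrite /del (negPf neqx).
(* The two violations give [#|S1| + #|S2| >= D * #|U1| + D * #|U2| + 2], whereas [leU] and [leI]
   allow an excess of only 1, due to [x0]. *)
have := cardsUI S1 S2; have := cardsUI U1 U2.
rewrite (cardsD1 x0 (S1 :&: S2)) inE S1x S2x /=.
move=> eqU eqS; have : D * #|U1 :|: U2| + D * #|U1 :&: U2| = D * #|U1| + D * #|U2|.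
  by rewrite -!mulnDr eqU.
by lia.
Qed.

Lemma greedy_colouring (T : finType) (e : rel T) (n : nat) :
  symmetric e -> irreflexive e -> (forall x, #|[set y | e x y]| < n) ->
  exists f : T -> 'I_n, forall x y, e x y -> f x != f y.
Proof.
move=> e_sym e_irr deg_lt.
suff [f fP] : exists f : T -> 'I_n,
    {in enum T &, forall x y, e x y -> f x != f y}.
  by exists f => x y; apply: fP; rewrite mem_enum.
elim: (enum T) => [|x s [f fP]].
  (* Without colours the degree bound leaves no vertex. *)
  case: n deg_lt => [|n] deg_lt; last by exists (fun=> ord0).
  have f (x : T) : 'I_0 by have := deg_lt x; rewrite ltn0.
  by exists f => x; rewrite in_nil.
have /subsetPn[b _ nb] : ~~ ([set: 'I_n] \subset f @: [set y | e x y]).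
  apply: contraL (leq_imset_card f [set y | e x y]) => /subset_leq_card.
  by rewrite cardsT card_ord -ltnNge => /(leq_trans (deg_lt x)).
have fb y : e x y -> f y != b.
  by move=> exy; apply: contraNneq nb => <-; apply: imset_f; rewrite inE.
exists (fun y => if y == x then b else f y) => y z.
rewrite !inE; case: (eqVneq y x) => [->|_] /=; case: (eqVneq z x) => [->|_] //= ys zs.
- by rewrite e_irr.
- by rewrite eq_sym; apply: fb.
- by rewrite e_sym => /fb.
- exact: fP.
Qed.

(** * Tail bounds by counting in a finite product space *)

Section Counting.

Variables (I A : finType).
Let q := #|A|.

(** Markov's inequality for [2 ^ X], where [X] is the number of hits. The coordinates are
    independent, and each of the at most [n] that can hit contributes a factor of at most
    [1 + 1 / q] to the mean. *)
Lemma few_overloaded (g : I -> pred A) (n T : nat) :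
  (forall i, #|[set a | g i a]| <= 1) ->
  #|[set i | [exists a, g i a]]| <= n ->
  #|[set w : {ffun I -> A} | T <= #|[set i | g i (w i)]|]| * 2 ^ T * q ^ n <=
  q.+1 ^ n * q ^ #|I|.
Proof.
move=> g_le1 le_n; set H := [set i | _] in le_n.
have moment : \sum_(w : {ffun I -> A}) 2 ^ #|[set i | g i (w i)]| <=
    q.+1 ^ #|H| * q ^ (#|I| - #|H|).
  have -> : \sum_(w : {ffun I -> A}) 2 ^ #|[set i | g i (w i)]| =
      \prod_(i : I) \sum_(a : A) 2 ^ g i a.
    rewrite bigA_distr_bigA; apply: eq_bigr => w _.
    by rewrite -sum1dep_card big_mkcond expn_sum; apply: eq_bigr => i _; case: (g i _).
  rewrite (bigID (mem H)) /= leq_mul //.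
    rewrite -prod_nat_const leq_prod // => i _.
    apply: (@leq_trans (\sum_(a : A) (1 + g i a))).
      by apply: leq_sum => a _; case: (g i a).
    rewrite big_split /= sum1_card -/q -addn1 leq_add2l (leq_trans _ (g_le1 i)) //.
    by rewrite -sum1dep_card [leqRHS]big_mkcond leq_sum // => a _; case: (g i a).
  have -> : #|I| - #|H| = #|~: H| by rewrite [RHS]cardsCs setCK.
  rewrite -prod_nat_const (eq_bigl (mem (~: H))); last by move=> i; rewrite !inE.
  rewrite leq_prod // => i; rewrite !inE negb_exists => /forallP ng.
  by rewrite (eq_bigr (fun=> 1)) ?sum1_card // => a _; rewrite (negPf (ng a)).
have markov : #|[set w : {ffun I -> A} | T <= #|[set i | g i (w i)]|]| * 2 ^ T <=
    \sum_(w : {ffun I -> A}) 2 ^ #|[set i | g i (w i)]|.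
  rewrite -sum_nat_const big_mkcond leq_sum // => w _; rewrite inE.
  by case: ifP => // leT; rewrite leq_exp2l.
apply: leq_trans (leq_mul (leq_trans markov moment) (leqnn (q ^ n))) _.
rewrite -(subnKC le_n) !expnD -!mulnA leq_mul2l; apply/orP; right.
rewrite mulnA -expnD subnK ?max_card // mulnC leq_mul2r; apply/orP; right.
by case: (n - _) => // m; rewrite leq_exp2r.
Qed.

Definition agree (z : {set I * A}) (w : {ffun I -> A}) :=
  [forall p in z, w p.1 == p.2].

(** The count factors over the coordinates: an unconstrained one keeps [q] values, one constraint
    leaves at most one value, and two different constraints leave none. *)
Lemma count_agree (z : {set I * A}) :
  #|[set w | agree z w]| * q ^ #|z| <= q ^ #|I|.
Proof.
pose F i := [set a | [forall p in z, (p.1 == i) ==> (a == p.2)]].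
have -> : #|[set w | agree z w]| = \prod_i #|F i|.
  under eq_bigr do rewrite -sum1_card big_mkcond.
  rewrite bigA_distr_bigA -sum1_card big_mkcond; apply: eq_bigr => w _.
  rewrite inE; case: ifPn => [/forall_inP wz|].
    rewrite big1 // => i _; rewrite inE ifT //; apply/forall_inP => p zp.
    by apply/implyP => /eqP <-; apply: wz.
  rewrite negb_forall_in => /exists_inP[p zp nwp].
  rewrite (bigD1 p.1) //= inE ifF //; apply/negbTE; rewrite negb_forall_in.
  by apply/exists_inP; exists p; rewrite // eqxx.
have -> : q ^ #|z| = \prod_i q ^ #|[set a | (i, a) \in z]|.
  rewrite -expn_sum; congr (_ ^ _); rewrite -sum1_card.
  under [RHS]eq_bigr do rewrite -sum1dep_card.
  by rewrite pair_big_dep /=; apply: eq_bigl => -[].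
rewrite -big_split /= -prod_nat_const leq_prod // => i _.
have [le1|/card_gt1P[a [b [za zb neq_ab]]]] := leqP #|[set a | (i, a) \in z]| 1.
  case cz: #|[set a | (i, a) \in z]| le1 => [|[|//]] _.
    by rewrite expn0 muln1 max_card.
  have /eqP/cards1P[a za] := cz.
  rewrite expn1 -[leqRHS]mul1n leq_mul2r -(cards1 a) orbC subset_leq_card //.
  apply/subsetP => b; rewrite !inE => /forall_inP/(_ (i, a)) /=.
  by rewrite eqxx; apply; move/setP/(_ a): za; rewrite !inE eqxx.
rewrite [X in X * _](_ : _ = 0) //; apply: eq_card0 => c; rewrite inE.
apply/negP => /forall_inP cz; move: za zb neq_ab; rewrite !inE => /cz + /cz.
by rewrite /= eqxx => /eqP<- /eqP<-; rewrite eqxx.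
Qed.

Definition has_disjoint_agreements (Z : {set {set I * A}}) (t : nat) w :=
  [exists f : {ffun 'I_t -> {set I * A}},
    [&& f \in ffun_on (mem Z), [forall l, agree (f l) w] &
        [forall l, forall m, (l != m) ==> [disjoint f l & f m]]]].

(* Every member of [Z] is charged [q ^ (2 - size)] out of [q ^ 2], so members
   of sizes 1 and 2 can be counted together. *)
Lemma few_agreements (Z : {set {set I * A}}) (t : nat) :
  (forall z, z \in Z -> #|z| <= 2) ->
  #|[set w | has_disjoint_agreements Z t w]| * q ^ (2 * t) <=
  q ^ #|I| * (\sum_(z in Z) q ^ (2 - #|z|)) ^ t.
Proof.
move=> Z_le2.
pose dis (f : {ffun 'I_t -> {set I * A}}) :=
  [forall l, forall m, (l != m) ==> [disjoint f l & f m]].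
pose B (f : {ffun 'I_t -> {set I * A}}) := [set w | [forall l, agree (f l) w]].
have sub : [set w | has_disjoint_agreements Z t w] \subset
    \bigcup_(f in [pred f in ffun_on (mem Z) | dis f]) B f.
  apply/subsetP => w; rewrite inE => /existsP[f /and3P[fZ fw fdis]].
  by apply/bigcupP; exists f; rewrite inE // fZ.
apply: leq_trans (leq_mul (subset_leq_card sub) (leqnn _)) _.
apply: leq_trans (leq_mul (leq_card_bigcup _ _) (leqnn _)) _.
have -> : (\sum_(z in Z) q ^ (2 - #|z|)) ^ t =
    \sum_(f in ffun_on (mem Z)) \prod_(l < t) q ^ (2 - #|f l|).
  by rewrite -[X in _ ^ X]card_ord -prod_nat_const bigA_distr_big.
rewrite big_distrl big_distrr /= [leqRHS](bigID dis) /=.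
rewrite (leq_trans _ (leq_addr _ _)) // leq_sum // => f /andP[/ffun_onP fZ /forallP fdis].
have BE : B f = [set w | agree (\bigcup_l f l) w].
  apply/setP => w; rewrite !inE; apply/forallP/forall_inP => [fw p|fw l].
    by case/bigcupP => l _ flp; apply: (forall_inP (fw l)).
  by apply/forall_inP => p flp; apply: fw; apply/bigcupP; exists l.
(* By disjointness the size of the union is the sum of the sizes, so the charges complete its power
   of [q] to [q ^ (2 * t)]. *)
have -> : q ^ (2 * t) = q ^ #|\bigcup_l f l| * \prod_(l < t) q ^ (2 - #|f l|).
  rewrite -sum1_card partition_disjoint_bigcup; last first.
    by move=> l m; move/forallP/(_ m)/implyP: (fdis l).
  under eq_bigr do rewrite sum1_card.
  rewrite -expn_sum -expnD -big_split /=.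
  under eq_bigr => l _ do rewrite subnKC ?Z_le2 ?fZ //.
  by rewrite sum_nat_const card_ord mulnC.
by rewrite mulnA leq_mul2r BE count_agree orbT.
Qed.

End Counting.

(** * A random sparse selection of edges *)

Section Balls.

Variable G : sgraph.
Implicit Types u v w : G.

Definition nbhd u : {set G} := [set w | adj u w].

Lemma deg_le_max u : deg u <= max_deg G.
Proof. exact: (leq_bigmax (F := @deg G)). Qed.

Lemma min_deg_le u : min_deg G <= deg u.
Proof.
rewrite /min_deg; elim: (index_enum _) (mem_index_enum u) => //= x s IHs.
rewrite inE big_cons => /orP[/eqP <-|/IHs]; first exact: geq_minl.
by apply: leq_trans; apply: geq_minr.
Qed.

(** Iterating closed neighbourhoods, instead of comparing with [dist], makes the cardinality bound a
    direct induction. *)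
Fixpoint ball n u : {set G} :=
  if n is n'.+1 then \bigcup_(w in ball n' u) (w |: nbhd w) else [set u].

Lemma ballSr n u : ball n.+1 u = \bigcup_(w in ball n u) (w |: nbhd w).
Proof. by []. Qed.

Lemma ball1 u : ball 1 u = u |: nbhd u.
Proof. exact: big_set1. Qed.

Lemma card_ball n u : #|ball n u| <= (max_deg G).+1 ^ n.
Proof.
elim: n => [|n IHn] /=; first by rewrite cards1.
rewrite (leq_trans (leq_card_bigcup _ _)) //.
apply: (@leq_trans (\sum_(w in ball n u) (max_deg G).+1)).
  by apply: leq_sum => w _; rewrite cardsU1 inE adj_irrefl add1n ltnS deg_le_max.
by rewrite sum_nat_const expnSr leq_mul2r IHn orbT.
Qed.

(** The definition grows a ball at its outer end; walks and symmetry need the first step peeled off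
    instead. *)
Lemma ballS n u : ball n.+1 u = \bigcup_(w in u |: nbhd u) ball n w.
Proof.
elim: n u => [|n IHn] u.
  rewrite ball1; apply/setP => v; apply/idP/bigcupP => [uv|[w uw]].
    by exists v; rewrite // inE.
  by rewrite inE => /eqP->.
rewrite [LHS]ballSr; apply/setP => v; apply/bigcupP/bigcupP => [[x]|[w uw]].
  by rewrite IHn => /bigcupP[w uw wx] xv; exists w => //; apply/bigcupP; exists x.
rewrite ballSr => /bigcupP[x wx xv]; exists x => //; rewrite IHn.
by apply/bigcupP; exists w.
Qed.

Lemma nbhd1_sym u v : (v \in u |: nbhd u) = (u \in v |: nbhd v).
Proof. by rewrite !inE eq_sym adj_sym. Qed.

Lemma ball_sym n u v : (v \in ball n u) = (u \in ball n v).
Proof.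
elim: n u v => [|n IHn] u v; first by rewrite !inE eq_sym.
rewrite [in RHS]ballS ballSr; apply/bigcupP/bigcupP => -[w]; rewrite IHn nbhd1_sym.
  by exists w.
by move=> wv uw; exists w => //; rewrite IHn.
Qed.

Lemma ball_mono m n u : m <= n -> ball m u \subset ball n u.
Proof.
move/subnK <-; elim: (n - m) => // d; move/subset_trans; apply.
by apply/subsetP => w uw; apply/bigcupP; exists w; rewrite // setU11.
Qed.

Lemma r_neighbours_ball r u v : r_neighbours r u v -> v \in ball r u.
Proof.
rewrite /r_neighbours /dist; case: {-}_ / idP => // uv.
case: ex_minnP => d /existsP[p /andP[pth /eqP <-]] _ /andP[_ le_dr].
apply: (subsetP (ball_mono u le_dr)); case: p pth => p /= /eqP <- {le_dr uv v}.
elim: p u => [|x p IHp] u; first by rewrite inE.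
case/andP => ux /IHp; rewrite ballS => xl; apply/bigcupP; exists x => //.
by rewrite !inE ux orbT.
Qed.

End Balls.

(** Bernoulli's inequality gives [q.+1 ^ m <= 2 * q ^ m] for [m.*2 <= q.+1], which applies to both
    halves of the exponent [q]. *)
Lemma expn_succ_le q : q.+1 ^ q <= 4 * q ^ q.
Proof.
have bern m : m <= q.+1 -> q.+1 ^ m * (q.+1 - m) <= q.+1 * q ^ m.
  elim: m => [|m IHm] lem; first by rewrite subn0 !expn0 mul1n muln1.
  have := IHm (ltnW lem); rewrite !expnS => IH.
  have {IH} : q * (q.+1 ^ m * (q.+1 - m)) <= q.+1 * (q * q ^ m).
    by rewrite [leqRHS]mulnCA leq_mul2l IH orbT.
  apply: leq_trans; rewrite mulnAC [leqRHS]mulnCA [leqRHS]mulnC leq_mul2r.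
  by apply/orP; right; nia.
have half m : m.*2 <= q.+1 -> q.+1 ^ m <= 2 * q ^ m.
  by move=> lem; have := bern m; nia.
have le1 : q.+1 ^ uphalf q <= 2 * q ^ uphalf q by apply: half; lia.
have le2 : q.+1 ^ q./2 <= 2 * q ^ q./2 by apply: half; lia.
have -> : q.+1 ^ q = q.+1 ^ uphalf q * q.+1 ^ q./2.
  by rewrite -expnD; congr (_ ^ _); lia.
have -> : q ^ q = q ^ uphalf q * q ^ q./2 by rewrite -expnD; congr (_ ^ _); lia.
by rewrite -[4]/(2 * 2) mulnACA leq_mul.
Qed.

Lemma leq_expl m n e : m <= n -> m ^ e <= n ^ e.
Proof. by case: e => // e; rewrite leq_exp2r. Qed.

(** Adjacency in the subgraph F': an edge belongs to it as soon as one of its ends selects it. *)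
Definition linked (X : eqType) k (h : X * 'I_k -> X) (x y : X) :=
  [exists i, h (x, i) == y] || [exists i, h (y, i) == x].

Section SparseSelection.

(* [T u v] stands for the old colours of [u] that are missing at [v]. *)
Variables (G : sgraph) (C : finType).
Variables (col : G -> G -> C) (T : G -> G -> {set C}).
Variables (r k q M a t : nat).
Let D := 2 * a + 1.
Implicit Types (u v w : G).

Hypothesis col_sym : forall u v, col u v = col v u.
Hypothesis col_inj : forall u v w, adj u v -> adj u w -> col u v = col u w -> v = w.
Hypothesis card_T : forall u v, #|T u v| <= k + D.
Hypothesis q_gt0 : 0 < q.
Hypothesis M_gt0 : 0 < M.
Hypothesis deg_ge : forall v, k * q <= deg v.
Hypothesis max_deg_le : max_deg G <= a * q.
Let d := 4 * (max_deg G).+1 ^ (r + 2).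
(** This and [q_big] are the rarity conditions of the local lemma. An overload has probability at
    most [2 ^ -M]; a conflict has at most the [t]-th power of the inner sum of [q_big] divided by
    [q]. *)
Hypothesis M_big : 4 * d <= 2 ^ M.
Hypothesis q_big :
  4 * d * ((k + D) * (2 * k * M) + a * (2 * k * M) ^ 2) ^ t <= q ^ t.

(* A slot (u, i, j) proposes an edge at u from the i-th of k disjoint blocks of
   q edges at u. *)
Local Notation slot := (vertex G * 'I_k * 'I_M)%type.
Implicit Types (s : slot) (x : 'I_q) (om : {ffun slot -> 'I_q}).

(** The default of [nth] is never reached: by [index_lt], [k] blocks of [q] edges fit into every
    neighbourhood. *)
Let tgt s x := nth s.1.1 (enum (nbhd s.1.1)) (s.1.2 * q + x).

Let index_lt (i : 'I_k) x u : i * q + x < size (enum (nbhd u)).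
Proof.
rewrite -cardE; apply: leq_trans (deg_ge u).
have := ltn_ord i; have := ltn_ord x; case: i x => i /= _ [x /= _]; nia.
Qed.

Let tgt_adj s x : adj s.1.1 (tgt s x).
Proof.
have : tgt s x \in enum (nbhd s.1.1) by rewrite mem_nth ?index_lt.
by rewrite mem_enum inE.
Qed.

Let tgt_inj u (i i' : 'I_k) (j j' : 'I_M) x x' :
  tgt (u, i, j) x = tgt (u, i', j') x' -> i = i' /\ x = x'.
Proof.
move/eqP; rewrite /tgt /= nth_uniq ?index_lt ?enum_uniq // => /eqP eqi.
have : (i * q + x) %/ q = (i' * q + x') %/ q by rewrite eqi.
rewrite !divnMDl // !divn_small ?ltn_ord // !addn0 => eii.
split; apply: val_inj => //=; move: eqi; rewrite eii; exact: addnI.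
Qed.

Let edge_of s x : {set G} := [set s.1.1; tgt s x].

Let sel om u v := [exists s, edge_of s (om s) == [set u; v]].

Let set2_eq u v w z : [set u; v] = [set w; z] :> {set G} ->
  (u = w /\ v = z) \/ (u = z /\ v = w).
Proof.
move=> E; have : (w \in [set u; v]) && (z \in [set u; v]) by rewrite E set21 set22.
have : (u \in [set w; z]) && (v \in [set w; z]) by rewrite -E set21 set22.
rewrite !inE => /andP[/orP[]/eqP ? /orP[]/eqP ?] /andP[/orP[]/eqP ? /orP[]/eqP ?];
  by subst; auto.
Qed.

(** These are the drawn edges at [u] whose loss is compatible with equal pallets at [u] and [v]
    after recolouring. The edge [u v], lost at both ends, is accounted for separately. *)
Let conflict om u v : {set G} := [set w | [&& adj u w, w != v, sel om u w &
  (col u w \in T u v) ||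
  [exists w', [&& adj v w', sel om v w' & col v w' == col u w]]]].

(** Diagonal pairs carry the overloads and the others the conflicts, so that a single index type
    serves both. *)
Let bad (p : G * G) om :=
  if p.1 == p.2 then D * M < #|[set s | tgt s (om s) == p.1]|
  else (p.2 \in ball r p.1) && (t <= #|conflict om p.1 p.2|).

(** Pairs out of range carry an impossible event; the empty set keeps them out of the dependency
    count. *)
Let owners (p : G * G) : {set slot} :=
  if p.2 \in ball r p.1
  then [set s | s.1.1 \in ball 1 p.1 :|: ball 1 p.2] else set0.

Let sel_dep om om' u w : adj u w ->
  (forall s, s.1.1 \in ball 1 u -> om s = om' s) -> sel om u w = sel om' u w.
Proof.
move=> uw eq_om; apply: eq_existsb => s.
suff E o o' : (forall s, s.1.1 \in ball 1 u -> o s = o' s) ->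
    edge_of s (o s) == [set u; w] -> edge_of s (o' s) == [set u; w].
  by apply/idP/idP; apply: E => // s' s'1; rewrite eq_om.
move=> eq_o Eo; rewrite -eq_o // ball1 !inE.
by move/eqP/set2_eq: Eo => [[-> _]|[-> _]]; rewrite ?eqxx ?uw ?orbT.
Qed.

Let bad_dep p : depends_on (owners p) (bad p).
Proof.
move: p => [u v] om om'; rewrite /owners /bad /=; case: eqP => [<-|_]; last first.
  case: ifP => //= _ eq_om; congr (_ <= _); apply: eq_card => w; rewrite !inE.
  apply: andb_id2l => uw; apply: andb_id2l => _; congr andb; last first.
    congr orb; apply: eq_existsb => w'; apply: andb_id2l => vw'.
    congr andb; apply: sel_dep => // s s1; apply: eq_om; rewrite !inE.
    by rewrite s1 orbT.
  apply: sel_dep => // s s1; apply: eq_om; rewrite !inE.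
  by rewrite s1.
rewrite ifT ?setUid; last by apply: (subsetP (ball_mono u (leq0n r))); rewrite inE.
move=> eq_om; congr (_ < _); apply: eq_card => s; rewrite !inE.
suff E o o' : {in [set s : slot | s.1.1 \in ball 1 u], o =1 o'} ->
    tgt s (o s) == u -> tgt s (o' s) == u.
  by apply/idP/idP; apply: E => // s' s'1; rewrite eq_om.
move=> eq_o Eo; rewrite -eq_o // inE ball1 !inE adj_sym -(eqP Eo).
by rewrite tgt_adj orbT.
Qed.

(** If the owners of [(u, v)] and of [p] meet, then [u] or [v] is within distance 2 of an end of
    [p], and the other one lies in a ball of radius [r] around it. *)
Let deg_owners p : #|[set p' | ~~ [disjoint owners p' & owners p]]| <= d.
Proof.
pose U := ball 2 p.1 :|: ball 2 p.2.
pose P := \bigcup_(y in U) [set (y, z) | z in ball r y].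
pose P' := \bigcup_(y in U) [set (z, y) | z in ball r y].
apply: (@leq_trans #|P :|: P'|).
  apply/subset_leq_card/subsetP => -[u v]; rewrite inE => /pred0Pn[s /andP[]].
  rewrite /= /owners /=; case: ifP => [uv|_]; last by rewrite inE.
  case: ifP => [_|_]; last by rewrite !inE.
  rewrite !inE => s1 s2.
  have near y y' : s.1.1 \in ball 1 y -> s.1.1 \in ball 1 y' -> y \in ball 2 y'.
    move=> sy sy'; rewrite ballSr; apply/bigcupP; exists s.1.1 => //.
    by rewrite -ball1 ball_sym.
  have nearU y : s.1.1 \in ball 1 y -> y \in U.
    by move=> sy; rewrite inE; apply/orP; case/orP: s2 => s2; [left|right]; apply: near.
  case/orP: s1 => /nearU sU; apply/orP; [left|right]; apply/bigcupP.
    by exists u => //; apply/imsetP; exists v.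
  by exists v => //; apply/imsetP; exists u; rewrite // ball_sym.
have leU : #|U| <= 2 * (max_deg G).+1 ^ 2.
  by rewrite mul2n -addnn (leq_trans (leq_card_setU _ _)) // leq_add // card_ball.
have aux (F : G -> {set G * G}) : (forall y, #|F y| <= (max_deg G).+1 ^ r) ->
    #|\bigcup_(y in U) F y| <= 2 * (max_deg G).+1 ^ (r + 2).
  move=> leF; rewrite (leq_trans (leq_card_bigcup _ _)) //.
  apply: (@leq_trans (\sum_(y in U) (max_deg G).+1 ^ r)); first exact: leq_sum.
  by rewrite sum_nat_const addnC expnD mulnA leq_mul2r leU orbT.
rewrite (leq_trans (leq_card_setU _ _)) // /d -[4]/(2 + 2) mulnDl.
by rewrite leq_add // aux // => y; rewrite (leq_trans (leq_imset_card _ _)) ?card_ball.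
Qed.

Let card_slot_fun : #|{: {ffun slot -> 'I_q}}| = q ^ #|{: slot}|.
Proof. by rewrite card_ffun card_ord. Qed.

(** A neighbour of [w] has [w] in at most one of its blocks, hence at most [M] slots that can reach
    it. The mean of [2 ^ X] is thus at most [4 ^ (a * M)], and [D = 2 * a + 1] leaves a margin of
    [2 ^ (M + 1)]. *)
Let rarely_overloaded w :
  #|[set om : {ffun slot -> 'I_q} | D * M < #|[set s | tgt s (om s) == w]|]| * (4 * d)
  <= #|{: {ffun slot -> 'I_q}}|.
Proof.
pose n := q * (a * M).
have g_le1 s : #|[set x | tgt s x == w]| <= 1.
  apply/card_le1_eqP => x y; rewrite !inE => /eqP <- /eqP.
  by case: s => [[u i] j] /tgt_inj[].
have le_n : #|[set s | [exists x, tgt s x == w]]| <= n.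
  pose f s := (s.1.1, s.2).
  rewrite -(@card_in_imset _ _ f); last first.
    move=> [[u i] j] [[u' i'] j']; rewrite !inE /f /=.
    move=> /existsP[x /eqP Ex] /existsP[x' /eqP Ex'] [eu ej]; subst u' j'.
    by have [-> _] := tgt_inj (etrans Ex (esym Ex')).
  apply: (@leq_trans #|setX (nbhd w) [set: 'I_M]|).
    apply/subset_leq_card/subsetP => -[u j] /imsetP[s]; rewrite !inE andbT.
    by case/existsP => x /eqP Ex [-> _]; rewrite adj_sym -Ex tgt_adj.
  rewrite cardsX cardsT card_ord /n mulnA leq_mul2r; apply/orP; right.
  by apply: leq_trans (deg_le_max w) _; rewrite mulnC.
have := few_overloaded (D * M).+1 g_le1 le_n.
set B := #|_|; rewrite card_ord card_slot_fun => leB.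
have pow : q.+1 ^ n <= 2 ^ (2 * (a * M)) * q ^ n.
  rewrite /n (expnM q.+1) (expnM q) (expnM 2) -expnMn.
  by case: (a * M) => // e; rewrite leq_exp2r // expn_succ_le.
have {leB pow} : B * 2 ^ (D * M).+1 * q ^ n <= 2 ^ (2 * (a * M)) * q ^ #|{: slot}| * q ^ n.
  by apply: leq_trans leB _; rewrite [leqRHS]mulnAC leq_mul2r pow orbT.
rewrite leq_pmul2r ?expn_gt0 ?q_gt0 // (_ : (D * M).+1 = 2 * (a * M) + (M + 1)); last first.
  by rewrite /D; lia.
rewrite expnD mulnCA leq_pmul2l ?expn_gt0 //; apply: leq_trans.
by rewrite leq_mul2l (leq_trans M_big) ?orbT // leq_exp2l // leq_addr.
Qed.

Let hits u w : {set slot * 'I_q} := [set p | edge_of p.1 p.2 == [set u; w]].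

Let card_hits u w : #|hits u w| <= 2 * k * M.
Proof.
pose f (p : slot * 'I_q) := p.1.
rewrite -(@card_in_imset _ _ f); last first.
  move=> [s x] [s' x'] /= + + ess'; rewrite /f /= in ess'; subst s'.
  rewrite !inE /= => /eqP E /eqP E'; congr pair.
  case: s E E' => [[v i] j]; rewrite /edge_of /= => E E'.
  have : tgt (v, i, j) x = tgt (v, i, j) x'.
    by have [[_ //]|[Ev Et]] := set2_eq (etrans E (esym E')); rewrite Et -Ev.
  by case/tgt_inj.
apply: (@leq_trans #|setX (setX [set u; w] [set: 'I_k]) [set: 'I_M]|).
  apply/subset_leq_card/subsetP => -[[v i] j] /imsetP[[s x]].
  rewrite inE /f /= => /eqP + Es; rewrite -{s}Es /edge_of /= => E.
  rewrite !inE !andbT.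
  by have := set21 v (tgt (v, i, j) x); rewrite E !inE.
by rewrite !cardsX !cardsT !card_ord !leq_mul // cards2; case: eqP.
Qed.

Let colour_of (p : slot * 'I_q) := col p.1.1.1 (tgt p.1 p.2).

Let hits_colour u w p : p \in hits u w -> colour_of p = col u w.
Proof.
by rewrite inE => /eqP/set2_eq[[E1 E2]|[E1 E2]]; rewrite /colour_of E1 E2 // col_sym.
Qed.

Let old_hits u v :=
  \bigcup_(w in [set w | [&& adj u w, w != v & col u w \in T u v]]) hits u w.

Let hit_pairs u v := \bigcup_(w in [set w | adj u w && (w != v)])
  \bigcup_(w' in [set w' | adj v w' && (col v w' == col u w)])
    setX (hits u w) (hits v w').

(** The possible witnesses of a conflict: one draw of an edge with colour in [T u v], or two draws
    of equally coloured edges at [u] and at [v]. *)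
Let items u v := [set [set p] | p in old_hits u v] :|:
  [set [set p.1; p.2] | p in hit_pairs u v].

Let card_old_hits u v : #|old_hits u v| <= (k + D) * (2 * k * M).
Proof.
rewrite (leq_trans (leq_card_bigcup _ _)) //.
apply: (@leq_trans (\sum_(w in
    [set w | [&& adj u w, w != v & col u w \in T u v]]) 2 * k * M)).
  by apply: leq_sum => w _; apply: card_hits.
rewrite sum_nat_const leq_mul2r; apply/orP; right; apply: leq_trans (card_T u v).
rewrite -(@card_in_imset _ _ (col u)); last first.
  move=> w w'; rewrite !inE => /and3P[uw _ _] /and3P[uw' _ _]; exact: col_inj.
by apply/subset_leq_card/subsetP => c /imsetP[w]; rewrite inE => /and3P[_ _ ?] ->.
Qed.

Let card_hit_pairs u v : #|hit_pairs u v| <= a * q * (2 * k * M) ^ 2.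
Proof.
rewrite (leq_trans (leq_card_bigcup _ _)) //.
apply: (@leq_trans (\sum_(w in [set w | adj u w && (w != v)]) (2 * k * M) ^ 2)).
  apply: leq_sum => w _; rewrite (leq_trans (leq_card_bigcup _ _)) //.
  apply: (@leq_trans (\sum_(w' in
      [set w' | adj v w' && (col v w' == col u w)]) (2 * k * M) ^ 2)).
    by apply: leq_sum => w' _; rewrite cardsX -mulnn leq_mul ?card_hits.
  rewrite sum_nat_const -[leqRHS]mul1n leq_mul2r; apply/orP; right.
  apply/card_le1_eqP => x y; rewrite !inE => /andP[vx /eqP Ex] /andP[vy /eqP Ey].
  by apply: (col_inj vy vx); rewrite Ex Ey.
rewrite sum_nat_const leq_mul2r; apply/orP; right; apply: leq_trans max_deg_le.
apply: leq_trans (deg_le_max u); apply/subset_leq_card/subsetP => w.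
by rewrite !inE => /andP[].
Qed.

(** One draw cannot serve both ends, as the common edge would be [u v], which is excluded. Hence
    these items really have size 2. *)
Let hit_pairs_neq u v p : u != v -> p \in hit_pairs u v -> p.1 != p.2.
Proof.
move=> neq_uv /bigcupP[w]; rewrite inE => /andP[uw neq_wv] /bigcupP[w'].
rewrite inE => /andP[vw' _]; rewrite !inE => /andP[/eqP E1 /eqP E2].
apply: contraNneq neq_uv => Ep; rewrite Ep E2 in E1.
by case: (set2_eq E1) => -[E _]; rewrite E ?eqxx in neq_wv *.
Qed.

(** Singletons are few but weigh [q], while the pairs weigh 1 and number of order [q] up to powers
    of [M]; both totals are thus linear in [q]. *)
Let items_weight u v : u != v ->
  \sum_(z in items u v) q ^ (2 - #|z|) <=
  q * ((k + D) * (2 * k * M) + a * (2 * k * M) ^ 2).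
Proof.
move=> neq_uv.
pose f (z : {set slot * 'I_q}) := q ^ (2 - #|z|).
apply: (@leq_trans (\sum_(z in [set [set p] | p in old_hits u v]) f z +
    \sum_(z in [set [set p.1; p.2] | p in hit_pairs u v]) f z)).
  rewrite !(big_mkcond (fun z => z \in _)) -big_split /= leq_sum // => z _.
  by rewrite inE; do 2!case: (z \in _) => //=; rewrite ?leq_addr ?leq_addl.
rewrite mulnDr leq_add //.
  apply: (@leq_trans (\sum_(z in [set [set p] | p in old_hits u v]) q)).
    by apply: leq_sum => z /imsetP[p _ ->]; rewrite /f cards1 expn1.
  rewrite sum_nat_const mulnC leq_mul2l (leq_trans (leq_imset_card _ _)) ?orbT //.
apply: (@leq_trans (\sum_(z in [set [set p.1; p.2] | p in hit_pairs u v]) 1)).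
  apply: leq_sum => z /imsetP[p /(hit_pairs_neq neq_uv) np ->].
  by rewrite /f cards2 np.
rewrite sum1_card (leq_trans (leq_imset_card _ _)) //.
by rewrite (leq_trans (card_hit_pairs u v)) // mulnCA mulnA.
Qed.

Let conflict_item om u v w : w \in conflict om u v ->
  exists2 z, z \in items u v & agree z om && [forall p in z, colour_of p == col u w].
Proof.
rewrite inE => /and4P[uw neq_wv /existsP[s Es]].
case/orP => [Tw|/existsP[w' /and3P[vw' /existsP[s' Es'] Ec]]].
  exists [set (s, om s)].
    rewrite inE; apply/orP; left; apply: imset_f; apply/bigcupP.
    by exists w; rewrite !inE ?uw ?neq_wv.
  apply/andP; split; apply/forall_inP => p; rewrite inE => /eqP-> //=.
  by rewrite (@hits_colour u w) ?inE.
exists [set (s, om s); (s', om s')].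
  rewrite inE; apply/orP; right; apply/imsetP; exists ((s, om s), (s', om s')) => //.
  apply/bigcupP; exists w; rewrite ?inE ?uw //.
  by apply/bigcupP; exists w'; rewrite !inE ?vw' //= Es.
apply/andP; split; apply/forall_inP => p; rewrite !inE => /orP[]/eqP-> //=.
  by rewrite (@hits_colour u w) ?inE.
by rewrite (@hits_colour v w') ?inE.
Qed.

(** All draws in an item chosen for [w] have colour [col u w]. Different [w] give different colours
    at [u], hence disjoint items. *)
Let conflict_agreements om u v : t <= #|conflict om u v| ->
  has_disjoint_agreements (items u v) t om.
Proof.
move=> let_t; pose w (l : 'I_t) := enum_val (widen_ord let_t l).
have w_conf l : w l \in conflict om u v by apply: enum_valP.
have w_adj l : adj u (w l) by have := w_conf l; rewrite inE => /and4P[].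
have w_inj : injective w.
  by move=> l m /enum_val_inj/(congr1 val) /= ?; apply: val_inj.
have zP l : exists z, [&& z \in items u v, agree z om &
    [forall p in z, colour_of p == col u (w l)]].
  by have [z z1 z2] := conflict_item (w_conf l); exists z; rewrite z1.
pose z l := xchoose (zP l).
apply/existsP; exists [ffun l => z l]; apply/and3P; split.
- by apply/ffun_onP => l; rewrite ffunE; case/and3P: (xchooseP (zP l)).
- by apply/forallP => l; rewrite ffunE; case/and3P: (xchooseP (zP l)).
apply/forallP => l; apply/forallP => m; apply/implyP; rewrite !ffunE.
apply: contraR => /pred0Pn[p /andP[/= pl pm]]; apply/eqP/w_inj.
case/and3P: (xchooseP (zP l)) => _ _ /forall_inP/(_ _ pl)/eqP cl.
case/and3P: (xchooseP (zP m)) => _ _ /forall_inP/(_ _ pm)/eqP cm.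
by apply: (col_inj (w_adj l) (w_adj m)); rewrite -cl -cm.
Qed.

Let rarely_conflicting u v : u != v ->
  #|[set om : {ffun slot -> 'I_q} | t <= #|conflict om u v|]| * (4 * d)
  <= #|{: {ffun slot -> 'I_q}}|.
Proof.
move=> neq_uv.
apply: (@leq_trans (#|[set om | has_disjoint_agreements (items u v) t om]| * (4 * d))).
  rewrite leq_mul2r subset_leq_card ?orbT //; apply/subsetP => om.
  by rewrite !inE; apply: conflict_agreements.
have items_le2 z : z \in items u v -> #|z| <= 2.
  by case/setUP => /imsetP[p _ ->]; rewrite ?cards1 // cards2; case: (_ != _).
have := few_agreements t items_le2; set B := #|_|; rewrite card_ord card_slot_fun => leB.
pose c := (k + D) * (2 * k * M) + a * (2 * k * M) ^ 2.
have {leB} : B * q ^ t * q ^ t <= q ^ #|{: slot}| * c ^ t * q ^ t.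
  rewrite -mulnA -expnD addnn -mul2n (leq_trans leB) // -mulnA leq_mul2l -expnMn.
  by apply/orP; right; apply: leq_expl; rewrite [leqRHS]mulnC; apply: items_weight.
rewrite leq_pmul2r ?expn_gt0 ?q_gt0 // => leB.
(* If the power vanishes, [leB] forces [B] to be 0; otherwise it can be cancelled. *)
have [c0|c_gt0] := posnP (c ^ t).
  move: leB; rewrite c0 muln0 leqn0 muln_eq0.
  by rewrite [_ ^ _ == 0]gtn_eqF ?expn_gt0 ?q_gt0 // orbF => /eqP->.
rewrite -(leq_pmul2r c_gt0); apply: leq_trans leB.
by rewrite -mulnA leq_mul2l q_big orbT.
Qed.

Lemma sparse_selection : exists h : G * 'I_k -> G,
  [/\ forall p, adj p.1 (h p),
      forall u, injective (fun i => h (u, i)),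
      forall w, #|[set p | h p == w]| <= D &
      forall u v, u != v -> v \in ball r u ->
        #|[set w | [&& adj u w, w != v, linked h u w &
          (col u w \in T u v) ||
          [exists w', [&& adj v w', linked h v w' & col v w' == col u w]]]]| < t].
Proof.
have [|||om om_good] := local_lemma _ bad_dep deg_owners.
- by rewrite /d muln_gt0 expn_gt0.
- move=> [u v]; rewrite /bad /=; case: eqP => [_|/eqP neq_uv].
    exact: rarely_overloaded.
  apply: leq_trans (rarely_conflicting neq_uv); rewrite leq_mul2r.
  rewrite subset_leq_card ?orbT //; apply/subsetP => om.
  by rewrite !inE => /andP[].
- by rewrite card_slot_fun expn_gt0 q_gt0.
pose N (p : G * 'I_k) := [set tgt (p, j) (om (p, j)) | j : 'I_M].
(* The groups of [S] make [#|S| * M] draws, and each of their targets receives at most [D * M]. *)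
have hallN (S : {set G * 'I_k}) : #|S| <= D * #|\bigcup_(p in S) N p|.
  rewrite -(leq_pmul2r M_gt0) mulnAC -[M in leqLHS]card_ord -cardsT -cardsX.
  apply: (@leq_trans #|\bigcup_(w in \bigcup_(p in S) N p) [set s | tgt s (om s) == w]|).
    apply/subset_leq_card/subsetP => -[p j]; rewrite !inE andbT => Sp.
    apply/bigcupP; exists (tgt (p, j) (om (p, j))); last by rewrite inE.
    by apply/bigcupP; exists p => //; apply: imset_f.
  rewrite (leq_trans (leq_card_bigcup _ _)) //.
  apply: (@leq_trans (\sum_(w in \bigcup_(p in S) N p) (D * M))).
    apply: leq_sum => w _; rewrite leqNgt; have := om_good (w, w).
    by rewrite /bad /= eqxx.
  by rewrite sum_nat_const mulnC.
have [h [hN h_le]] := hall_capacity hallN.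
have hE p : exists j, h p = tgt (p, j) (om (p, j)).
  by have /imsetP[j _ ->] := hN p; exists j.
have h_sel (x y : G) : [exists i, h (x, i) == y] -> sel om x y.
  case/existsP => i /eqP <-; have [j ->] := hE (x, i).
  by apply/existsP; exists (x, i, j).
exists h; split=> [p|u i i'|//|u v neq_uv uv].
- by have [j ->] := hE p; apply: (tgt_adj (p, j)).
- by have [j ->] := hE (u, i); have [j' ->] := hE (u, i') => /tgt_inj[].
have linked_sel (x y : G) : linked h x y -> sel om x y.
  case/orP => /h_sel // /existsP[s s_xy]; apply/existsP; exists s.
  by rewrite setUC.
have := om_good (u, v); rewrite /bad /= (negPf neq_uv) uv /= -ltnNge.
apply: leq_ltn_trans; apply/subset_leq_card/subsetP => w; rewrite !inE.
case/and4P => -> -> /linked_sel -> /= /orP[-> //|/existsP[w' /and3P[vw' lw' cw']]].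
by apply/orP; right; apply/existsP; exists w'; rewrite vw' linked_sel.
Qed.

End SparseSelection.

(** * Recolouring the selected edges *)

Section Recolouring.

Variables (G : sgraph) (K : nat) (c : colouring G K).
Hypothesis c_proper : proper_total c.

Let c_vv u v : adj u v -> c (inl u) != c (inl v).
Proof. by case/and3P: c_proper => /forallP/(_ u)/forallP/(_ v)/implyP. Qed.

Let c_ee (e f : edge G) v :
  v \in val e -> v \in val f -> c (inr e) = c (inr f) -> e = f.
Proof.
move=> ve vf /eqP; apply: contraTeq => neq_ef.
case/and3P: c_proper => _ /forallP/(_ e)/forallP/(_ f)/implyP + _; apply.
by rewrite neq_ef; apply/set0Pn; exists v; rewrite inE ve.
Qed.

Let c_ev (e : edge G) v : v \in val e -> c (inr e) != c (inl v).
Proof. by case/and3P: c_proper => _ _ /forallP/(_ e)/forallP/(_ v)/implyP. Qed.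

(** The value [None] off the edges gives a function on all pairs of vertices, the form that
    [sparse_selection] takes. *)
Definition edge_colour (u v : G) : option 'I_K :=
  omap (fun e => c (inr e)) (insub [set u; v]).

Lemma edge_ends (e : edge G) v :
  v \in val e -> exists2 w, adj v w & val e = [set v; w].
Proof.
case: e => A /= /existsP[x /existsP[y /andP[xy /eqP->]]] /set2P[->|->].
  by exists y.
by exists x; rewrite 1?adj_sym // setUC.
Qed.

Lemma adj_edge (u w : G) : adj u w -> exists e : edge G, val e = [set u; w].
Proof.
move=> uw; suff P : is_edge [set u; w] by exists (Sub _ P).
by apply/existsP; exists u; apply/existsP; exists w; rewrite uw /=.
Qed.

Lemma edge_colourE (u w : G) (e : edge G) :
  val e = [set u; w] -> edge_colour u w = Some (c (inr e)).
Proof. by rewrite /edge_colour => <-; rewrite valK. Qed.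

Lemma edge_colour_sym (u v : G) : edge_colour u v = edge_colour v u.
Proof. by rewrite /edge_colour setUC. Qed.

Lemma edge_colour_inj (u v w : G) :
  adj u v -> adj u w -> edge_colour u v = edge_colour u w -> v = w.
Proof.
move=> uv uw; have [e Ee] := adj_edge uv; have [f Ef] := adj_edge uw.
rewrite (edge_colourE Ee) (edge_colourE Ef) => -[].
move/(@c_ee _ _ u); rewrite Ee Ef !set21 => /(_ isT isT) eef.
have : v \in [set u; w] by rewrite -Ef -eef Ee set22.
by case/set2P => // vu; rewrite vu adj_irrefl in uv.
Qed.

(** Cutting off large differences makes the size bound unconditional. The cut is harmless: if
    recolouring makes the pallets equal, the difference is small. *)
Definition foreign (n : nat) (u v : G) : {set option 'I_K} :=
  let S := pallet c u :\: pallet c v in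
  if #|S| <= n then [set Some x | x in S] else set0.

Lemma card_foreign n u v : #|foreign n u v| <= n.
Proof.
rewrite /foreign; case: ifP => [|_]; last by rewrite cards0.
by apply: leq_trans; apply: leq_imset_card.
Qed.

Variables (r t D : nat) (h : G * 'I_t.+1 -> G).
Hypothesis h_adj : forall p, adj p.1 (h p).
Hypothesis h_inj : forall u, injective (fun i => h (u, i)).
Hypothesis h_le : forall w, #|[set p | h p == w]| <= D.
Hypothesis h_sparse : forall u v, u != v -> v \in ball r u ->
  #|[set w | [&& adj u w, w != v, linked h u w &
    (edge_colour u w \in foreign (t.+1 + D) u v) ||
    [exists w', [&& adj v w', linked h v w' &
      edge_colour v w' == edge_colour u w]]]]| < t.

(** At each end an edge of F' meets at most [t + D] others, so [2 * (t + D) + 1] colours suffice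
    greedily. *)
Let N := 2 * (t.+1 + D) - 1.

Let F (e : edge G) := [exists p, val e == [set p.1; h p]].

Let F_linked u w (e : edge G) : val e = [set u; w] -> F e = linked h u w.
Proof.
move=> Ee; apply/existsP/orP => [[[x i]]|[]/existsP[i /eqP E]]; rewrite ?Ee.
- rewrite eqEsubset !subUset !sub1set !inE /= => /andP[/andP[+ +] /andP[+ +]].
  have := h_adj (x, i); rewrite /= => xh.
  have neq : x == h (x, i) = false by apply: contraTF xh => /eqP<-; rewrite adj_irrefl.
  case/orP => /eqP->; case/orP => /eqP->; rewrite ?eqxx ?neq // ?[_ == x]eq_sym ?neq // => _ _.
    by left; apply/existsP; exists i.
  by right; apply/existsP; exists i.
- by exists (u, i); rewrite /= E.
- by exists (w, i); rewrite /= E setUC.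
Qed.

Let inc v := [set e : edge G | F e & v \in val e].

Let card_inc v : #|inc v| <= t.+1 + D.
Proof.
rewrite -(card_imset _ val_inj).
apply: (@leq_trans #|[set [set p.1; h p] |
    p in [set p | p.1 == v] :|: [set p | h p == v]]|).
  apply/subset_leq_card/subsetP => A /imsetP[e]; rewrite inE.
  case/andP => /existsP[p /eqP Ep] + ->; rewrite Ep => /set2P vp.
  by apply: imset_f; rewrite !inE; apply/orP; case: vp => ->; [left|right].
rewrite (leq_trans (leq_imset_card _ _)) // (leq_trans (leq_card_setU _ _)) //.
rewrite leq_add //; apply: (@leq_trans #|setX [set v] [set: 'I_t.+1]|).
  by apply/subset_leq_card/subsetP => -[x i]; rewrite !inE andbT.
by rewrite cardsX cards1 cardsT card_ord mul1n.
Qed.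

Let meet (e f : edge G) := [&& e != f, F e, F f & val e :&: val f != set0].

Let meet_lt e : #|[set f | meet e f]| < N.
Proof.
have [Fe|nFe] := boolP (F e); last first.
  rewrite eq_card0 ?/N; first by lia.
  by move=> f; rewrite inE /meet (negPf nFe) andbF.
have [u [w EA]] : exists u, exists w, val e = [set u; w].
  by case: (e) => A /= /existsP[u /existsP[w /andP[_ /eqP]]]; exists u, w.
have sub : [set f | meet e f] \subset (inc u :\ e) :|: (inc w :\ e).
  apply/subsetP => f; rewrite !inE /meet eq_sym => /and4P[-> _ -> /set0Pn[x]].
  by rewrite inE EA => /andP[/set2P[]-> ->]; rewrite ?orbT.
apply: leq_ltn_trans (subset_leq_card sub) _.
apply: leq_ltn_trans (leq_card_setU _ _) _.
have cu := card_inc u; have cw := card_inc w.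
rewrite (cardsD1 e) inE Fe EA set21 in cu.
rewrite (cardsD1 e) inE Fe EA set22 in cw.
by rewrite /N; lia.
Qed.

Let R u := [set c (inr e) | e in inc u].

Lemma recoloured : distinguishing_total_colourable G r (K + N).
Proof.
have meet_sym : symmetric meet.
  by move=> e f; rewrite /meet eq_sym setIC [F e && _]andbCA.
have meet_irr : irreflexive meet by move=> e; rewrite /meet eqxx.
have [f f_proper] := greedy_colouring meet_sym meet_irr meet_lt.
pose c' : colouring G (K + N) := [ffun x => match x with
  | inl v => lshift N (c (inl v))
  | inr e => if F e then rshift K (f e) else lshift N (c (inr e)) end].
apply/existsP; exists c'; apply/andP; split.
  apply/and3P; split; apply/forallP => x; apply/forallP => y; apply/implyP.
  - by move/c_vv; rewrite !ffunE (inj_eq (@lshift_inj _ _)).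
  - case/andP => neq_xy xy; have [z] := set0Pn _ xy; rewrite inE => /andP[zx zy].
    rewrite !ffunE; case: ifP => Fx; case: ifP => Fy; rewrite ?eq_lrshift ?eq_rlshift //.
      by rewrite (inj_eq (@rshift_inj _ _)) f_proper // /meet neq_xy Fx Fy.
    rewrite (inj_eq (@lshift_inj _ _)); apply: contra neq_xy => /eqP.
    by move/(c_ee zx zy) => ->.
  - move=> yx; rewrite !ffunE; case: ifP => _; first by rewrite eq_rlshift.
    by rewrite (inj_eq (@lshift_inj _ _)) c_ev.
(* By properness of [c], a colour lost at [u] occurs nowhere else in the pallet of [u], so it really
   disappears. *)
have kept u x : (lshift N x \in pallet c' u) = (x \in pallet c u :\: R u).
  rewrite !inE !ffunE (inj_eq (@lshift_inj _ _)).
  apply/idP/andP => [|[nR]].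
    case/orP => [/eqP->|/imsetP[e]].
      rewrite eqxx; split=> //; apply/imsetP => -[e]; rewrite inE => /andP[_ ue] /esym/eqP.
      by rewrite (negPf (c_ev ue)).
    rewrite inE ffunE => ue; case: ifP => [_ /eqP|nFe /lshift_inj ->].
      by rewrite eq_lrshift.
    split; last by apply/orP; right; apply: imset_f; rewrite inE.
    apply/imsetP => -[e']; rewrite inE => /andP[Fe' ue'] /(c_ee ue ue') ee'.
    by rewrite ee' Fe' in nFe.
  case/orP => [->//|/imsetP[e]]; rewrite inE => ue Ex; apply/orP; right.
  apply/imsetP; exists e; rewrite ?inE // ffunE ifF ?Ex //.
  by apply: contraNF nR => Fe; rewrite Ex; apply: imset_f; rewrite inE Fe.
apply/forallP => u; apply/forallP => v; apply/implyP => uv.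
apply/eqP => eq_pallet.
have eqSR : pallet c u :\: R u = pallet c v :\: R v.
  by apply/setP => x; rewrite -!kept eq_pallet.
have neq_uv := r_neighbours_neq uv.
have := h_sparse neq_uv (r_neighbours_ball uv); apply/negP; rewrite -leqNgt.
(* A colour of [u] foreign to [v] must have been lost by [u], so there are at most as many as
   selected edges at [u]. *)
have foreignE : foreign (t.+1 + D) u v = [set Some x | x in pallet c u :\: pallet c v].
  rewrite /foreign ifT //; apply: leq_trans (card_inc u).
  apply: leq_trans (leq_imset_card (fun e => c (inr e)) _).
  apply/subset_leq_card/subsetP => x; rewrite inE => /andP[nSv Su].
  apply: contraNT nSv => nR; have : x \in pallet c u :\: R u by rewrite inE nR.
  by rewrite eqSR inE => /andP[].
(* The vertex [u] selects [t.+1] different neighbours; discarding [v] leaves at least [t]. *)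
apply: (@leq_trans #|[set h (u, i) | i : 'I_t.+1] :\ v|).
  have := cardsD1 v [set h (u, i) | i : 'I_t.+1].
  by rewrite (card_imset _ (@h_inj u)) card_ord; case: (v \in _); lia.
apply/subset_leq_card/subsetP => w; rewrite !inE => /andP[-> /imsetP[i _ ->]] /=.
have uh := h_adj (u, i); rewrite /= in uh; rewrite uh /=.
have lu : linked h u (h (u, i)) by apply/orP; left; apply/existsP; exists i.
rewrite lu /= foreignE; have [e Ee] := adj_edge uh.
rewrite (edge_colourE Ee).
have ue : u \in val e by rewrite Ee set21.
have Re : c (inr e) \in R u by apply: imset_f; rewrite inE (F_linked Ee) lu.
have Se : c (inr e) \in pallet c u.
  by rewrite !inE; apply/orP; right; apply: imset_f; rewrite inE.
have [Sv|nSv] := boolP (c (inr e) \in pallet c v); last first.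
  by apply/orP; left; apply: imset_f; rewrite inE nSv.
apply/orP; right; have /imsetP[e' + Ee'] : c (inr e) \in R v.
  apply: contraTT Re => nR; have : c (inr e) \in pallet c v :\: R v by rewrite inE nR.
  by rewrite -eqSR inE => /andP[].
rewrite inE => /andP[Fe' /edge_ends[w' vw' E']].
by apply/existsP; exists w'; rewrite vw' -(F_linked E') Fe' (edge_colourE E') Ee' eqxx.
Qed.

End Recolouring.

(** * Choice of the parameters *)

(** With [m = n %/ e.+1], [2 ^ n] contains [e.+1] factors [2 ^ m]: one absorbs the constant [b], the
    others absorb [n ^ e]. *)
Lemma exp2_dominates c e : exists n0, forall n, n0 <= n -> c * n ^ e <= 2 ^ n.
Proof.
pose b := c * e.+1 ^ e; exists (b * e.+1) => n; rewrite -leq_divRL // => le_b.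
set m := n %/ e.+1 in le_b.
have lt_n : n <= e.+1 * 2 ^ m.
  apply: (@leq_trans (m.+1 * e.+1)); first by rewrite ltnW // ltn_ceil.
  by rewrite mulnC leq_mul2l ltn_expl.
apply: (@leq_trans (b * (2 ^ m) ^ e)).
  by rewrite /b -mulnA -expnMn leq_mul2l leq_expl ?orbT.
apply: (@leq_trans (2 ^ m * (2 ^ m) ^ e)).
  by rewrite leq_mul2r (leq_trans le_b) ?orbT // ltnW // ltn_expl.
by rewrite -expnS -expnM leq_exp2l // leq_trunc_div.
Qed.

(** Taking [t = r + 4] leaves two factors [q] beyond those matching [(max_deg G).+1 ^ (r + 2)]: one
    absorbs the constant [e], the other the logarithmic term [M ^ (2 * t)]. *)
Lemma distinguishing_of_total (r a : nat) : 0 < a ->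
  exists Delta0, forall (G : sgraph) K,
  Delta0 <= max_deg G -> max_deg G <= a * (min_deg G %/ r.+4.+1) ->
  total_colourable G K ->
  distinguishing_total_colourable G r (K + (2 * (r.+4.+1 + (2 * a + 1)) - 1)).
Proof.
move=> a_gt0; pose k := r.+4.+1; pose t := r.+4; pose D := 2 * a + 1.
pose b := (k + D) * (2 * k) + a * (2 * k) ^ 2.
pose e := 16 * (2 * a) ^ (r + 2) * b ^ t.
have [n0 n0P] := exp2_dominates (2 * a * (r + 6) ^ (2 * t)) (2 * t).
exists (maxn (2 ^ n0) (maxn 1 (a * e))) => G K.
rewrite !geq_max => /and3P[Delta_n0 Delta_gt0 Delta_e] max_deg_le.
move=> /existsP[c c_proper]; set q := min_deg G %/ _ in max_deg_le.
have q_e : e <= q by rewrite -(leq_pmul2l a_gt0) (leq_trans Delta_e).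
have q_gt0 : 0 < q.
  by have := leq_trans Delta_gt0 max_deg_le; rewrite muln_gt0 => /andP[].
pose L := up_log 2 (max_deg G).+1.
have leL : (max_deg G).+1 <= 2 ^ L by rewrite up_logP.
have L_gt0 : 0 < L by rewrite lt0n; apply: contraTneq leL => ->; rewrite -ltnNge.
have Lmin : 2 ^ L <= 2 * max_deg G.
  rewrite -(prednK L_gt0) expnS leq_mul2l /=.
  by rewrite -ltnS up_log_gtn.
have n0_le : n0 <= L by rewrite -(@leq_exp2l 2) // (leq_trans Delta_n0) // ltnW.
(* The multiple of [L] covers the power of the maximum degree, and the summand 4 gives the factor 16
   in [M_big]. *)
pose M := (r + 2) * L + 4.
have M_gt0 : 0 < M by rewrite /M addn4.
have leM : M <= (r + 6) * L by rewrite /M; nia.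
have M_q : M ^ (2 * t) <= q.
  rewrite -(leq_pmul2l a_gt0); apply: leq_trans max_deg_le.
  rewrite -(@leq_pmul2l 2) // (leq_trans _ Lmin) // (leq_trans _ (n0P _ n0_le)) //.
  have : M ^ (2 * t) <= (r + 6) ^ (2 * t) * L ^ (2 * t) by rewrite -expnMn leq_expl.
  by rewrite -!mulnA !leq_mul2l => ->; rewrite !orbT.
have M_big : 4 * (4 * (max_deg G).+1 ^ (r + 2)) <= 2 ^ M.
  have -> : 2 ^ M = 16 * (2 ^ L) ^ (r + 2).
    by rewrite /M addnC expnD (mulnC (r + 2)) expnM.
  by rewrite mulnA leq_mul2l leq_expl ?orbT.
have deg_ge (v : G) : k * q <= deg v.
  by rewrite mulnC (leq_trans (leq_trunc_div _ _)) // min_deg_le.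
have q_big : 4 * (4 * (max_deg G).+1 ^ (r + 2)) *
    ((k + D) * (2 * k * M) + a * (2 * k * M) ^ 2) ^ t <= q ^ t.
  have le1 : (max_deg G).+1 <= 2 * a * q.
    by rewrite -mulnA mul2n -addnn -addn1 leq_add // muln_gt0 a_gt0.
  have le2 : (k + D) * (2 * k * M) + a * (2 * k * M) ^ 2 <= b * M ^ 2.
    rewrite /b [leqRHS]mulnDl (expnMn (2 * k)) [a * (_ * _)]mulnA leq_add2r [leqLHS]mulnA.
    by rewrite leq_mul2l expnS leq_pmulr ?expn1 ?orbT.
  have := leq_mul (leq_expl (r + 2) le1) (leq_expl t le2).
  set X := _.+1 ^ _; set Y := (_ + _) ^ _; rewrite !(expnMn _ _ (r + 2)) (expnMn b) -expnM.
  set A := 2 ^ _ * _ => le3; apply: (@leq_trans (q ^ (r + 2) * (e * M ^ (2 * t)))).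
    have -> : e * M ^ (2 * t) = 16 * (A * (b ^ t * M ^ (2 * t))).
      by rewrite /e /A -!(expnMn _ _ (r + 2)) !mulnA.
    rewrite mulnA -mulnA [leqRHS]mulnCA leq_mul2l; apply/orP; right.
    by rewrite mulnA (mulnC _ A).
  rewrite (_ : q ^ t = q ^ (r + 2) * (q * q)) ?leq_mul //.
  by rewrite mulnn -expnD; congr (_ ^ _); rewrite /t; lia.
have [h [h_adj h_inj h_le h_sparse]] := sparse_selection (@edge_colour_sym G K c)
  (edge_colour_inj c_proper) (card_foreign c (k + D)) q_gt0 M_gt0 deg_ge
  max_deg_le M_big q_big.
exact: (recoloured c_proper h_adj h_inj h_le h_sparse).
Qed.

Import Order.TTheory GRing.Theory Num.Theory.
Local Open Scope ring_scope.

(** Rounding gives only [n < x * (q + 1)] with [x = k / eps]. As [n >= a * a] forces [q >= x], the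
    extra [x] is absorbed by the unit by which [a] exceeds [x]. *)
Lemma max_deg_le_blocks (R : realFieldType) (eps : R) (n m k a : nat) :
  0 < eps -> (0 < k)%N -> k%:R / eps + 1 <= a%:R -> eps * n%:R <= m%:R ->
  (a * a <= n)%N -> (n <= a * (m %/ k))%N.
Proof.
move=> eps0 k0 le_a le_m le_n; set q := (m %/ k)%N; set x := k%:R / eps in le_a.
have k0' : (0 : R) < k%:R by rewrite ltr0n.
have x_gt0 : 0 < x by rewrite divr_gt0.
have xe : x * eps = k%:R by rewrite /x mulfVK // gt_eqF.
have lt_m : (m < q.+1 * k)%N by rewrite ltn_ceil.
have lt_n : n%:R < x * (q%:R + 1).
  rewrite -(ltr_pM2l eps0) (le_lt_trans le_m) // mulrA [eps * x]mulrC xe.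
  by rewrite mulrC natr1 -natrM ltr_nat.
have le_n' : a%:R * a%:R <= n%:R :> R by rewrite -natrM ler_nat.
have q_ge : x <= q%:R by nra.
by rewrite -(ler_nat R) natrM; nra.
Qed.

Theorem theorem9 (R : realType) (C1 : R) (hC1 : molloy_reed_constant C1)
    (eps : R) (heps0 : 0 < eps) (heps1 : eps <= 1) (r : nat) (hr : (0 < r)%N) :
  exists (Delta0 : nat) (C2 : R),
    C2 <= eps ^- 2 * (7 * r%:R + 170) + r%:R + 5 /\
    forall G : sgraph,
      eps * (max_deg G)%:R <= (min_deg G)%:R ->
      (Delta0 <= max_deg G)%N ->
      (distinguishing_total_number G r)%:R <= (max_deg G)%:R + C1 + C2.
Proof.
have [D0 hD0] := hC1.
(* This choice gives [x + 1 <= a <= x + 2]: the lower bound serves [max_deg_le_blocks], the upper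
   one the estimate of [C2]. *)
pose x : R := r.+4.+1%:R / eps; pose a := (Num.truncn x).+2.
have x_ge0 : 0 <= x by rewrite divr_ge0 ?ler0n ?ltW.
have /andP[a_le a_gt] := truncn_itv x_ge0.
have aE : a%:R = (Num.truncn x)%:R + 2 :> R by rewrite -natrD addn2.
have [Delta1 hDelta1] := @distinguishing_of_total r a isT.
pose N := (2 * (r.+4.+1 + (2 * a + 1)) - 1)%N.
exists (maxn D0 (maxn Delta1 (a * a))), N%:R; split.
  have NE : N%:R = 2 * r%:R + 11 + 4 * a%:R :> R.
    rewrite (_ : N = 2 * r + 11 + 4 * a)%N; last by rewrite /N; lia.
    by rewrite 2!natrD 2!natrM.
  set y := eps^-1; have y_ge1 : 1 <= y by rewrite invf_ge1.
  have xE : x = (r%:R + 5) * y by rewrite /x -natrD addnS addn4.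
  have r0 : 0 <= r%:R :> R by rewrite ler0n.
  rewrite -exprVn -/y NE aE.
  (* What remains is [4 * (r + 5) * y + 2 * r + 19] against the claimed bound, which follows from
     [1 <= y <= y ^+ 2]. *)
  have y_le : y <= y ^+ 2.
    by rewrite expr2 ler_peMl // (le_trans ler01).
  have ry_le := ler_wpM2l r0 y_le; have r_le := ler_wpM2l r0 y_ge1.
  by move: a_le; rewrite xE; lra.
move=> G le_min; rewrite !geq_max => /and3P[le_D0 le_D1 le_aa].
have le_total := hD0 G le_D0.
have tot : total_colourable G (total_chromatic_number G).
  by rewrite /total_chromatic_number; case: ex_minnP.
have le_blocks : (max_deg G <= a * (min_deg G %/ r.+4.+1))%N.
  apply: (@max_deg_le_blocks R eps _ (min_deg G)) => //.
  by move: a_gt; rewrite -natr1 aE -/x; lra.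
have dist := hDelta1 G _ le_D1 le_blocks tot.
have : (distinguishing_total_number G r <= total_chromatic_number G + N)%N.
  by rewrite /distinguishing_total_number; case: ex_minnP => m _; apply.
rewrite -(ler_nat R) natrD => le_dist.
by rewrite (le_trans le_dist) // lerD2r.
Qed.
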